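(* Let $A$ be an $n\times n$ integer matrix with nonzero determinant. Assume that $A$ is diagonalizable and that there is a unique eigenvalue $\lambda_1$ of maximal modulus, which is real and negative. Assume also that the eigenvalues of $A$ are arranged as $(-\lambda_1)>|\lambda_2|\ge|\lambda_3|\ge\cdots\ge|\lambda_m|$ for some $m$. Then there are two positive constants $C_0,C_1$, not necessarily distinct, satisfying $1\le C_0\le C_1^2$, such that $$\deg(f_A^{2k+l})=C_l\cdot|\lambda_1|^{2k+l}+O(|\lambda_2|^{2k+l})\qquad(k\to\infty)$$ for $l=0,1$.
   Context: For an integer matrix $A=(a_{i,j})$ of size $n\times n$, $f_A$ denotes the monomial map $f_A(x_1,\dots,x_n)=(\prod_j x_j^{a_{1,j}},\dots,\prod_j x_j^{a_{n,j}})$ and also the rational map $\mathbb{P}^n\dashrightarrow\mathbb{P}^n$ it induces via the embedding $(X_1,\dots,X_n)\mapsto[1;X_1;\dots;X_n]$. $f_A^k$ is the $k$-th iterate, equal to $f_{A^k}$. The degree $\deg(f)$ of a rational map $f:\mathbb{P}^n\dashrightarrow\mathbb{P}^n$ is the common degree of the homogeneous polynomials without common factor defining $f$ (equivalently, the integer by which $f^*$ acts on $\mathrm{Pic}(\mathbb{P}^n)\cong\mathbb{Z}$). Diagonalizable means over $\mathbb{C}$; $\lambda_1,\dots,\lambda_m$ are the distinct eigenvalues of $A$. If $m=1$ the error term is understood to be $0$. *)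

(* Defs.v *)
From HB Require Import structures.
From mathcomp Require Import all_boot all_order all_algebra.
From mathcomp Require Import boolp classical_sets.
From mathcomp Require Import mpoly.

Set Implicit Arguments.
Unset Strict Implicit.
Unset Printing Implicit Defensive.

Import GRing.Theory.
Local Open Scope ring_scope.

Section MonomialMaps.
Variables (F : fieldType) (n : nat).

(* Only meaningful on the torus (all coordinates nonzero), which it maps to
   itself, so that iterating it there is iterating the rational map. *)
Definition monomial_map (A : 'M[int]_n) (x : 'I_n -> F) : 'I_n -> F :=
  fun i => \prod_(j < n) x j ^ A i j.

Definition in_torus (x : 'I_n -> F) : Prop := forall j, x j != 0.

(* (X_1, ..., X_n) |-> [1; X_1; ...; X_n] *)
Definition proj_embed (x : 'I_n -> F) : 'I_n.+1 -> F :=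
  fun i => oapp x 1 (unlift ord0 i).

Definition no_common_factor (P : 'I_n.+1 -> {mpoly F[n.+1]}) : Prop :=
  forall h : {mpoly F[n.+1]},
    (forall i, exists q, P i = h * q) -> h \is a GRing.unit.

(* [P_0; ...; P_n] is the rational self-map of P^n induced by the self-map g
   of the torus.  Equality of points of P^n is written as vanishing of the
   2x2 minors, so that nothing is required where all the P_i vanish; they
   cannot vanish on the whole torus when F is infinite and the P_i have no
   common factor. *)
Definition represents (P : 'I_n.+1 -> {mpoly F[n.+1]})
    (g : ('I_n -> F) -> ('I_n -> F)) : Prop :=
  forall x, in_torus x -> forall i j,
    (P i).@[proj_embed x] * proj_embed (g x) j =
    (P j).@[proj_embed x] * proj_embed (g x) i.

Definition has_degree (g : ('I_n -> F) -> ('I_n -> F)) (d : nat) : Prop :=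
  exists P : 'I_n.+1 -> {mpoly F[n.+1]},
    [/\ forall i, P i \is d.-homog, no_common_factor P & represents P g].

(* Such a d is unique when F is infinite; the junk value is 0. *)
Definition rat_degree (g : ('I_n -> F) -> ('I_n -> F)) : nat :=
  xget 0%N [set d | has_degree g d].

End MonomialMaps.

(* Main.v *)
Require Import Defs.
From mathcomp Require Import all_boot all_order all_algebra.
From mathcomp Require Import complex.
From mathcomp Require Import boolp classical_sets reals.
From mathcomp Require mpoly.

(** The degree of the rational map induced by an integer matrix B is a
    piecewise linear function of B, namely [mondeg B]: homogenizing f_B gives
    n + 1 Laurent monomials whose exponent vectors are the rows of
    [homogenize B]; clearing the denominators multiplies all of them by the
    least monomial that makes every exponent nonnegative, and since all rows of
    [homogenize B] sum to 0, the common degree is the degree of that multiplier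
    ([has_degree_monomial_map], [rat_degree_iter]).

    The formula makes sense for real matrices, and there [mondeg] is positively
    homogeneous, subadditive (hence Lipschitz, [mondeg_lipschitz]),
    submultiplicative ([mondegM]), and vanishes only at 0 ([mondeg_eq0]).

    As A is diagonalizable, A^N = lambda1^N P + E_N, where P is the spectral
    projection of the eigenvalue lambda1 and the entries of E_N are bounded by
    a constant times |lambda2|^N ([spectral_error]); P is a real matrix because
    complex conjugation permutes the spectral projections of a real matrix and
    lambda1 is real ([spectral_proj_real]).  Therefore
      mondeg (A^N) = |lambda1|^N mondeg ((-1)^N P) + O(|lambda2|^N),
    which is the expansion with C_0 = mondeg P and C_1 = mondeg (- P).
    Finally P is a nonzero idempotent, so C_0 > 0 and submultiplicativity
    applied to P = P P gives C_0 <= C_0^2, that is 1 <= C_0, while applied to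
    P = (- P) (- P) it gives C_0 <= C_1^2. *)

Set Implicit Arguments.
Unset Strict Implicit.
Unset Printing Implicit Defensive.

Import Order.TTheory GRing.Theory Num.Theory.
Local Open Scope ring_scope.
Local Open Scope complex_scope.

(** * The degree as a piecewise linear function of the matrix *)

Section Homogenization.
Variables (K : pzRingType) (n : nat).
Implicit Types B : 'M[K]_n.

(** Exponents of the Laurent monomials that express f_B in homogeneous
    coordinates: substituting X_j / X_0 for x_j moves the row sums of B, with a
    minus sign, to the new column 0, and row 0 is the coordinate 1 of the
    target. *)
Definition homogenize B : 'M[K]_n.+1 :=
  @block_mx K 1 n 1 n 0 0 (- (B *m const_mx 1)) B.

Lemma homogenize_row0 B j : homogenize B ord0 j = 0.
Proof.
have -> : ord0 = lshift n (ord0 : 'I_1) by exact: val_inj.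
rewrite /homogenize -[j](@splitK 1 n).
case: split => k /=.
  by rewrite (@block_mxEul _ 1 n 1 n) mxE.
by rewrite (@block_mxEur _ 1 n 1 n) mxE.
Qed.

Lemma homogenize_lift B i j : homogenize B (lift ord0 i) (lift ord0 j) = B i j.
Proof.
have liftE k : lift ord0 k = rshift 1 k :> 'I_n.+1 by exact: val_inj.
by rewrite !liftE /homogenize (@block_mxEdr _ 1 n 1 n).
Qed.

Lemma homogenize_rowsum B i : \sum_j homogenize B i j = 0.
Proof.
case: (unliftP ord0 i) => [k|] ->; last first.
  by rewrite big1 // => j _; rewrite homogenize_row0.
rewrite big_ord_recl (eq_bigr (fun j => B k j)) => [|j _]; last first.
  exact: homogenize_lift.
rewrite (_ : homogenize B _ _ = - \sum_j B k j) ?addNr //.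
have -> : lift ord0 k = rshift 1 k :> 'I_n.+1 by exact: val_inj.
have -> : ord0 = lshift n (ord0 : 'I_1) :> 'I_n.+1 by exact: val_inj.
by rewrite /homogenize (@block_mxEdl _ 1 n 1 n) !mxE; congr (- _);
  apply: eq_bigr => j _; rewrite mxE mulr1.
Qed.

Lemma homogenize_col0 B i : homogenize B (lift ord0 i) ord0 = - \sum_j B i j.
Proof.
apply/eqP; rewrite -addr_eq0; apply/eqP.
rewrite -[RHS](homogenize_rowsum B (lift ord0 i)) big_ord_recl; congr (_ + _).
by apply: eq_bigr => j _; rewrite homogenize_lift.
Qed.

(** Homogenization is B |-> L B R with fixed rectangular matrices such that
    R L = 1. *)
Lemma homogenizeM B C : homogenize (B *m C) = homogenize B *m homogenize C.
Proof.
rewrite /homogenize (@mulmx_block K 1 n 1 n 1 n) !mul0mx !mulmx0 !add0r mulmxN.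
by rewrite mulmxA.
Qed.

Lemma homogenizeD B C : homogenize (B + C) = homogenize B + homogenize C.
Proof.
by rewrite /homogenize (@add_block_mx K 1 n 1 n) !addr0 mulmxDl opprD.
Qed.

Lemma homogenizeZ c B : homogenize (c *: B) = c *: homogenize B.
Proof.
rewrite /homogenize (@scale_block_mx K 1 n 1 n) !scaler0 scalerN.
by rewrite scalemxAl.
Qed.

End Homogenization.

Lemma homogenize_map (K L : pzRingType) (f : {rmorphism K -> L}) (n : nat)
  (B : 'M[K]_n) : homogenize (map_mx f B) = map_mx f (homogenize B).
Proof.
rewrite /homogenize (@map_block_mx K L f 1 n 1 n) map_mxN map_mxM !raddf0.
by rewrite map_const_mx rmorph1.
Qed.

Section Degree.
Variable K : realDomainType.

(** The highest order of a pole along X_j = 0 among Laurent monomials whose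
    exponents are the rows of C. *)
Definition pole_order (p q : nat) (C : 'M[K]_(p, q)) (j : 'I_q) : K :=
  \big[Num.max/0]_(i < p) - C i j.

(** For an integer matrix, the degree of the rational map that it induces. *)
Definition mondeg (n : nat) (B : 'M[K]_n) : K :=
  \sum_j pole_order (homogenize B) j.

Lemma pole_order_ge0 p q (C : 'M[K]_(p, q)) j : 0 <= pole_order C j.
Proof. exact: bigmax_ge_id. Qed.

Lemma pole_order_ge p q (C : 'M[K]_(p, q)) i j : - C i j <= pole_order C j.
Proof. exact: le_bigmax. Qed.

Lemma pole_order_le p q (C : 'M[K]_(p, q)) j b :
  0 <= b -> (forall i, - C i j <= b) -> pole_order C j <= b.
Proof. by move=> b0 Cb; apply: bigmax_le. Qed.

(** The default value 0 of the maximum is no obstruction, since it is the value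
    taken in row 0. *)
Lemma pole_order_attained n (B : 'M[K]_n) j :
  exists i, homogenize B i j + pole_order (homogenize B) j = 0.
Proof.
suff [->|[i ->]] : pole_order (homogenize B) j = 0 \/
    exists i, pole_order (homogenize B) j = - homogenize B i j.
- by exists ord0; rewrite homogenize_row0 addr0.
- by exists i; rewrite subrr.
rewrite /pole_order; apply: (big_ind (fun x => x = 0 \/
    exists i, x = - homogenize B i j)); [by left| |].
  by move=> x y; rewrite /Num.max; case: ifP.
by move=> i _; right; exists i.
Qed.

Lemma pole_orderD p q (C D : 'M[K]_(p, q)) j :
  pole_order (C + D) j <= pole_order C j + pole_order D j.
Proof.
apply: pole_order_le => [|i]; first by rewrite addr_ge0 ?pole_order_ge0.
by rewrite mxE opprD lerD ?pole_order_ge.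
Qed.

Lemma pole_orderZ p q c (C : 'M[K]_(p, q)) j : 0 <= c ->
  pole_order (c *: C) j = c * pole_order C j.
Proof.
move=> c0; apply/le_anti/andP; split.
  apply: pole_order_le => [|i]; first by rewrite mulr_ge0 ?pole_order_ge0.
  by rewrite mxE -mulrN ler_wpM2l ?pole_order_ge.
have [->|cn0] := eqVneq c 0; first by rewrite mul0r pole_order_ge0.
have c_gt0 : 0 < c by rewrite lt_def cn0.
rewrite /pole_order.
apply: (big_ind (fun x => c * x <= pole_order (c *: C) j)).
- by rewrite mulr0 pole_order_ge0.
- by move=> x y; rewrite /Num.max; case: ifP.
- by move=> i _; rewrite mulrN; have := pole_order_ge (c *: C) i j; rewrite mxE.
Qed.

Lemma mondeg_ge0 n (B : 'M[K]_n) : 0 <= mondeg B.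
Proof. by apply: sumr_ge0 => j _; apply: pole_order_ge0. Qed.

Lemma mondegZ n c (B : 'M[K]_n) : 0 <= c -> mondeg (c *: B) = c * mondeg B.
Proof.
move=> c0; rewrite /mondeg mulr_sumr homogenizeZ.
by apply: eq_bigr => j _; rewrite pole_orderZ.
Qed.

Lemma mondegD n (B C : 'M[K]_n) : mondeg (B + C) <= mondeg B + mondeg C.
Proof.
rewrite /mondeg -big_split homogenizeD /=.
by apply: ler_sum => j _; apply: pole_orderD.
Qed.

(** If no coordinate has a pole, then all exponents are nonnegative, and as each
    row of exponents sums to 0 they all vanish. *)
Lemma mondeg_eq0 n (B : 'M[K]_n) : mondeg B = 0 -> B = 0.
Proof.
move=> /eqP; rewrite psumr_eq0 => [/allP pole0|j _]; last exact: pole_order_ge0.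
have hB_ge0 i j : 0 <= homogenize B i j.
  rewrite -oppr_le0; apply: le_trans (pole_order_ge _ i j) _.
  by rewrite (eqP (pole0 j (mem_index_enum j))).
apply/matrixP => i j; rewrite mxE -homogenize_lift.
have /eqP := homogenize_rowsum B (lift ord0 i).
rewrite psumr_eq0 // => /allP hB0; apply/eqP; exact: hB0 (mem_index_enum _).
Qed.

(** This is deg (f g) <= deg f * deg g, in a form that covers real matrices.
    Let p and q be the pole orders of the homogenizations b and c.
    Composing homogeneous representatives amounts to expanding a sum of
    products (b i k + p k) (c k j + q j) of nonnegative exponents.  It bounds
    each pole order of the product by [mondeg B * q j] plus a correction
    [r j] common to all the rows i, and the corrections add up to 0 because
    the rows of [c] sum to 0. *)
Lemma mondegM n (B C : 'M[K]_n) : mondeg (B *m C) <= mondeg B * mondeg C.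
Proof.
set b := homogenize B; set c := homogenize C.
(* The part of the expansion that does not depend on the row index. *)
pose r j := \sum_k pole_order b k * c k j.
have le_pole j : pole_order (b *m c) j <= mondeg B * pole_order c j + r j.
  have bound i : - (b *m c) i j <= mondeg B * pole_order c j + r j.
    have : 0 <= \sum_k (b i k + pole_order b k) * (c k j + pole_order c j).
      apply: sumr_ge0 => k _; rewrite mulr_ge0 // addrC -lerBlDr sub0r;
        exact: pole_order_ge.
    rewrite (eq_bigr (fun k => b i k * c k j + b i k * pole_order c j +
      (pole_order b k * c k j + pole_order b k * pole_order c j))); last first.
      by move=> k _; rewrite mulrDl !mulrDr.
    rewrite !big_split /= -!mulr_suml homogenize_rowsum mul0r addr0.
    by rewrite -lerBlDl sub0r mxE addrC.
  apply: pole_order_le => //.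
  (* Row 0 shows that the bound is nonnegative. *)
  have : - (b *m c) ord0 j <= mondeg B * pole_order c j + r j by [].
  by rewrite -homogenizeM homogenize_row0 oppr0.
rewrite /mondeg homogenizeM -/b -/c.
apply: le_trans (ler_sum _ (fun j _ => le_pole j)) _.
rewrite big_split /= -mulr_sumr /r exchange_big /=.
rewrite [X in _ + X]big1 ?addr0 // => k _.
by rewrite -mulr_sumr homogenize_rowsum mulr0.
Qed.

Lemma mondeg_le n (B : 'M[K]_n) e : 0 <= e -> (forall i j, `|B i j| <= e) ->
  mondeg B <= e *+ (n + n).
Proof.
move=> e0 Be; rewrite /mondeg big_ord_recl mulrnDr lerD //.
  apply: pole_order_le => [|i]; first exact: mulrn_wge0.
  case: (unliftP ord0 i) => [k|] ->; last first.
    by rewrite homogenize_row0 oppr0 mulrn_wge0.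
  rewrite homogenize_col0 opprK -[n in leRHS]card_ord -sumr_const.
  by apply: ler_sum => j _; apply: le_trans (ler_norm _) (Be k j).
rewrite -[n in leRHS]card_ord -sumr_const; apply: ler_sum => j _.
apply: pole_order_le => // i; case: (unliftP ord0 i) => [k|] ->; last first.
  by rewrite homogenize_row0 oppr0.
by rewrite homogenize_lift; apply: le_trans (ler_norm _) _; rewrite normrN.
Qed.

Lemma mondeg_lipschitz n (B C : 'M[K]_n) e : 0 <= e ->
  (forall i j, `|(B - C) i j| <= e) -> `|mondeg B - mondeg C| <= e *+ (n + n).
Proof.
move=> e0 BCe; rewrite ler_norml lerNl opprB !lerBlDr; apply/andP; split.
  rewrite -[in leLHS](subrK B C); apply: le_trans (mondegD _ _) _.
  rewrite lerD2r mondeg_le // => i j.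
  by have := BCe i j; rewrite -normrN !mxE opprB.
rewrite -[in leLHS](subrK C B); apply: le_trans (mondegD _ _) _.
by rewrite lerD2r mondeg_le.
Qed.

End Degree.

Lemma mondeg_intr (K : realDomainType) n (B : 'M[int]_n) :
  mondeg (map_mx intr B) = (mondeg B)%:~R :> K.
Proof.
rewrite /mondeg raddf_sum /=; apply: eq_bigr => j _.
rewrite /pole_order homogenize_map.
rewrite (big_morph (fun z : int => z%:~R : K) (id1 := 0) (op1 := Num.max)) //;
  last by move=> x y; rewrite /= !maxEle ler_int; case: ifP.
by apply: eq_bigr => i _; rewrite mxE rmorphN.
Qed.

(** * Kronecker substitution *)

Section Kronecker.
Import mpoly.

(** Uniqueness of base N expansions. *)
Lemma digits_inj (N n : nat) (f g : 'I_n -> nat) :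
  (forall i, f i < N)%N -> (forall i, g i < N)%N ->
  (\sum_(i < n) f i * N ^ i = \sum_(i < n) g i * N ^ i)%N -> f =1 g.
Proof.
elim: n f g => [|n IHn] f g fN gN; first by move=> _ [].
have sumE (h : 'I_n.+1 -> nat) : (\sum_(i < n.+1) h i * N ^ i =
    (\sum_(i < n) h (lift ord0 i) * N ^ i) * N + h ord0)%N.
  rewrite big_ord_recl expn0 muln1 addnC big_distrl /=; congr (_ + _)%N.
  by apply: eq_bigr => i _; rewrite -mulnA -expnSr.
have N_gt0 : (0 < N)%N by apply: leq_ltn_trans (fN ord0).
rewrite !sumE => eq_fg.
have eq0 : f ord0 = g ord0.
  by have /(congr1 (modn^~ N)) := eq_fg; rewrite /= !modnMDl !modn_small.
have /IHn eqS : (\sum_(i < n) f (lift ord0 i) * N ^ i =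
                 \sum_(i < n) g (lift ord0 i) * N ^ i)%N.
  have /(congr1 (divn^~ N)) := eq_fg.
  by rewrite /= !divnMDl // !divn_small // !addn0.
by move=> i; case: (unliftP ord0 i) => [j ->|->//]; apply: eqS.
Qed.

Variables (F : numFieldType) (n : nat).
Implicit Types (p q h : {mpoly F[n]}) (m : 'X_{1.. n}).

(** The Kronecker substitution of the powers X^(N^i) for the variables: when N
    exceeds all the degrees at hand it sends distinct monomials to distinct
    powers, and so reduces questions on polynomials in several variables to
    the case of one variable. *)
Definition kronecker (N : nat) : {mpoly F[n]} -> {poly F} :=
  mmap (@polyC F) (fun i : 'I_n => 'X^(N ^ i)).

Definition kronecker_exp (N : nat) m : nat := (\sum_(i < n) m i * N ^ i)%N.

Lemma kroneckerX N m : kronecker N 'X_[m] = 'X^(kronecker_exp N m).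
Proof.
rewrite /kronecker mmapX /mmap1 /kronecker_exp expr_sum.
by apply: eq_bigr => i _; rewrite mulnC exprM.
Qed.

Lemma kroneckerE N p :
  kronecker N p = \sum_(m <- msupp p) p@_m *: 'X^(kronecker_exp N m).
Proof.
rewrite [in LHS](mpolyE p) /kronecker raddf_sum; apply: eq_bigr => m _.
by rewrite /= mmapZ -mul_polyC -kroneckerX.
Qed.

Lemma coef_kronecker N p m : (msize p <= N)%N -> (mdeg m < N)%N ->
  (kronecker N p)`_(kronecker_exp N m) = p@_m.
Proof.
move=> pN mN; rewrite kroneckerE coef_sum.
have small k : (mdeg k < N)%N -> forall i, (k i < N)%N.
  move=> kN i; apply: leq_ltn_trans kN; rewrite mdegE.
  by rewrite (bigD1 i) //= leq_addr.
have inj k : k \in msupp p -> k != m ->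
    p@_k * (kronecker_exp N m == kronecker_exp N k)%:R = 0.
  move=> kp; apply: contraNeq => neq0; apply/eqP/mnmP/(@digits_inj N).
  - by apply: small; apply: leq_trans (msize_mdeg_lt kp) pN.
  - exact: small.
  - have [/esym//|neq] := eqVneq (kronecker_exp N m) (kronecker_exp N k).
    by rewrite (negPf neq) mulr0 eqxx in neq0.
have [mp|mNp] := boolP (m \in msupp p); last first.
  rewrite (memN_msupp_eq0 mNp) big1_seq // => k /andP[_ kp].
  by rewrite coefZ coefXn inj //; apply: contraNneq mNp => <-.
rewrite (bigD1_seq m) ?msupp_uniq //= coefZ coefXn eqxx mulr1.
rewrite big1_seq ?addr0 // => k /andP[km kp].
by rewrite coefZ coefXn inj.
Qed.

Lemma horner_kronecker N p t :
  (kronecker N p).[t] = p.@[fun i : 'I_n => t ^+ (N ^ i)].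
Proof.
rewrite kroneckerE mevalE horner_sum; apply: eq_bigr => m _.
rewrite hornerZ hornerXn /kronecker_exp expr_sum; congr (_ * _).
by apply: eq_bigr => i _; rewrite mulnC exprM.
Qed.

Lemma poly_eq0_units (q : {poly F}) : (forall t, t != 0 -> q.[t] = 0) -> q = 0.
Proof.
move=> q0; apply/eqP; apply: contraT => qn0.
have := @max_poly_roots _ q [seq i.+1%:R | i <- iota 0 (size q)] qn0.
rewrite size_map size_iota ltnn; apply.
  by apply/allP => _ /mapP[i _ ->]; rewrite /root q0 // pnatr_eq0.
by rewrite map_inj_uniq ?iota_uniq // => i j /eqP; rewrite eqr_nat => /eqP[].
Qed.

Lemma mpoly_eq0_torus p :
  (forall x : 'I_n -> F, in_torus x -> p.@[x] = 0) -> p = 0.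
Proof.
move=> p0; apply/mpolyP => m; rewrite mcoeff0.
have <- := @coef_kronecker (maxn (msize p) (mdeg m).+1) p m; last 2 first.
- exact: leq_maxl.
- exact: leq_maxr.
rewrite (_ : kronecker _ p = 0) ?coef0 //.
apply: poly_eq0_units => t t0; rewrite horner_kronecker p0 // => i.
by rewrite expf_neq0.
Qed.

(** The Kronecker substitution turns a divisor of a monomial into a divisor of a
    power of X, hence into a power of X up to a constant. *)
Lemma dvd_mpolyX h q m : h * q = 'X_[m] ->
  exists c m', c != 0 /\ h = c *: 'X_[m'].
Proof.
move=> hq; pose N := maxn (msize h) 1.
have : kronecker N h %| 'X^(kronecker_exp N m).
  by rewrite -kroneckerX -hq [X in _ %| X]rmorphM dvdp_mulr.
rewrite -['X]subr0 => /dvdp_exp_XsubCP[k _].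
rewrite subr0 => /eqpf_eq[c c0 kE].
have hN : (msize h <= N)%N by rewrite leq_maxl.
have hX m' : m' \in msupp h -> kronecker_exp N m' = k /\ h@_m' = c.
  move=> m'h; have h0 : h@_m' != 0 by rewrite -mcoeff_msupp.
  have m'N : (mdeg m' < N)%N by apply: leq_trans hN; apply: msize_mdeg_lt.
  move: h0; rewrite -(coef_kronecker hN m'N) kE coefZ coefXn.
  by have [->|_] := eqVneq (kronecker_exp N m') k; rewrite ?mulr0 ?mulr1 ?eqxx.
have hn0 : h != 0.
  apply: contraNneq (oner_neq0 F) => h0.
  have /(congr1 (mcoeff m)) := hq.
  by rewrite h0 mul0r mcoeff0 mcoeffX eqxx => /esym/eqP.
exists c, (mlead h); split => //.
have lead_h := mlead_supp hn0.
have lN : (mdeg (mlead h) < N)%N by apply: leq_trans hN; apply: msize_mdeg_lt.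
apply/mpolyP => m'; rewrite mcoeffZ mcoeffX.
have [<-|neq] := eqVneq (mlead h) m'; first by rewrite mulr1 (hX _ lead_h).2.
rewrite mulr0; apply/eqP; rewrite mcoeff_eq0; apply: contra neq => m'h.
apply/eqP/mnmP/(@digits_inj N).
- move=> i; apply: leq_ltn_trans lN; rewrite mdegE.
  by rewrite (bigD1 i) //= leq_addr.
- move=> i; apply: leq_ltn_trans (leq_trans (msize_mdeg_lt m'h) hN).
  by rewrite mdegE (bigD1 i) //= leq_addr.
- by rewrite -!/(kronecker_exp _ _) (hX _ lead_h).1 (hX _ m'h).1.
Qed.

End Kronecker.

(** * Representatives by coprime monomials *)

Section MonomialTuples.
Import mpoly.
Variables (F : numFieldType) (n : nat) (e : 'I_n.+1 -> 'X_{1.. n.+1}).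
Hypothesis e_min : forall t, exists i, e i t = 0%N.

(** A common factor is itself a monomial up to a constant, and no variable can
    divide all the given monomials. *)
Lemma no_common_factor_monomials :
  no_common_factor (fun i => 'X_[e i] : {mpoly F[n.+1]}).
Proof.
move=> h h_dvd; have [q0 /esym/dvd_mpolyX[c [m [c0 hE]]]] := h_dvd ord0.
suff m0 : m = 0%MM.
  rewrite hE m0 mpolyX0 -mul_mpolyC mulr1; apply/unitrP; exists (c^-1%:MP).
  by rewrite -!mpolyCM mulVf // mulfV.
apply/mnmP => t; rewrite mnm0E; have [i eit] := e_min t.
have [q qE] := h_dvd i.
have : e i \in msupp (c *: q * 'X_[m]).
  by rewrite -scalerAl mulrC scalerAl -hE -qE msuppX inE.
rewrite (perm_mem (msuppMX _ _)) => /mapP[m' _ /mnmP/(_ t)].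
by rewrite mnmDE eit => /esym/eqP; rewrite addn_eq0 => /andP[/eqP].
Qed.

(** A tuple of polynomials proportional to coprime monomials is a multiple of
    them.  To see that X^(e i) divides P i, compare for each variable t the
    exponents of t in P i X^(e j) = P j X^(e i), where j is such that t does not
    divide X^(e j). *)
Lemma common_multiple_of_monomials (P : 'I_n.+1 -> {mpoly F[n.+1]}) :
  (forall i j, P i * 'X_[e j] = P j * 'X_[e i]) ->
  exists H, forall i, P i = H * 'X_[e i].
Proof.
move=> PE.
have le_supp i m : m \in msupp (P i) -> (e i <= m)%MM.
  move=> mP; apply/mnm_lepP => t; have [j ejt] := e_min t.
  have : (e j + m)%MM \in msupp (P i * 'X_[e j]).
    by rewrite (perm_mem (msuppMX _ _)) map_f.
  rewrite PE (perm_mem (msuppMX _ _)) => /mapP[m' _ /mnmP/(_ t)].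
  by rewrite !mnmDE ejt add0n => ->; rewrite leq_addr.
pose H i := \sum_(m <- msupp (P i)) (P i)@_m *: 'X_[m - e i] : {mpoly F[n.+1]}.
have HE i : P i = H i * 'X_[e i].
  rewrite [in LHS](mpolyE (P i)) /H mulr_suml; apply: eq_big_seq => m mP.
  by rewrite -scalerAl -mpolyXD submK // le_supp.
have X_neq0 m : 'X_[m] != 0 :> {mpoly F[n.+1]}.
  by rewrite -msupp_eq0 msuppX.
exists (H ord0) => i; rewrite [LHS]HE; congr (_ * _).
apply: (mulIf (X_neq0 (e i))); apply: (mulIf (X_neq0 (e ord0))).
by rewrite -HE PE [in LHS]HE mulrAC.
Qed.

(** The degree does not depend on the representative: the multiplier given by
    the previous lemma is a common factor, hence a constant. *)
Lemma degree_of_monomials (d : nat) (P : 'I_n.+1 -> {mpoly F[n.+1]}) :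
  (forall i, P i \is d.-homog) -> no_common_factor P ->
  (forall i j, P i * 'X_[e j] = P j * 'X_[e i]) -> d = mdeg (e ord0).
Proof.
move=> homP ncf /common_multiple_of_monomials[H PE].
have : H \is a GRing.unit by apply: ncf => i; exists 'X_[e i].
have := homP ord0; rewrite PE => homH /andP[/eqP HE unitH].
move: homH; rewrite HE mul_mpolyC => /dhomogP/(_ (e ord0)) <- //.
by rewrite msuppMCX ?inE // -unitfE.
Qed.

End MonomialTuples.

(** * The degree of a monomial map and of its iterates *)

Section DegreeOfMonomialMaps.
Import mpoly.
Variables (F : numFieldType) (n : nat).
Implicit Types (x : 'I_n -> F) (y : 'I_n.+1 -> F) (B : 'M[int]_n).

Lemma dhomog_meval (d : nat) (p : {mpoly F[n.+1]}) c y : p \is d.-homog ->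
  p.@[fun i => c * y i] = c ^+ d * p.@[y].
Proof.
move=> /dhomogP homp; rewrite !mevalE mulr_sumr; apply: eq_big_seq => m mp.
rewrite mulrCA; congr (_ * _); rewrite -(homp _ mp) /= mdegE.
by rewrite expr_sum -big_split; apply: eq_bigr => i _; rewrite exprMn.
Qed.

Lemma proj_embed0 x : proj_embed x ord0 = 1.
Proof. by rewrite /proj_embed unlift_none. Qed.

Lemma proj_embed_lift x i : proj_embed x (lift ord0 i) = x i.
Proof. by rewrite /proj_embed liftK. Qed.

Lemma proj_embed_torus x : in_torus x -> in_torus (proj_embed x).
Proof.
move=> x0 i; case: (unliftP ord0 i) => [j|] ->.
  by rewrite proj_embed_lift.
by rewrite proj_embed0 oner_neq0.
Qed.

Lemma proj_embed_monomial B x i : in_torus x ->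
  proj_embed (monomial_map B x) i =
  \prod_j proj_embed x j ^ homogenize B i j.
Proof.
move=> x0; rewrite big_ord_recl proj_embed0 exp1rz mul1r.
case: (unliftP ord0 i) => [k|] ->.
  rewrite proj_embed_lift; apply: eq_bigr => j _.
  by rewrite proj_embed_lift homogenize_lift.
by rewrite proj_embed0 big1 // => j _; rewrite homogenize_row0.
Qed.

(** The homogeneous representative of f_B: the Laurent monomials of
    [homogenize B] after the poles have been cleared. *)
Definition cleared_exponent B (i : 'I_n.+1) : 'X_{1.. n.+1} :=
  [multinom `|(homogenize B i j + pole_order (homogenize B) j)%R|%N | j < n.+1].

Lemma cleared_exponentE B i j : (cleared_exponent B i j : int) =
  homogenize B i j + pole_order (homogenize B) j.
Proof.
rewrite mnmE gez0_abs // addrC -lerBlDr sub0r; exact: pole_order_ge.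
Qed.

Lemma cleared_exponent_min B j : exists i, cleared_exponent B i j = 0%N.
Proof.
have [i hij] := pole_order_attained B j; exists i.
by apply/eqP; rewrite -eqz_nat cleared_exponentE hij.
Qed.

Lemma mdeg_cleared_exponent B i :
  (mdeg (cleared_exponent B i) : int) = mondeg B.
Proof.
rewrite mdegE (big_morph Posz PoszD erefl).
rewrite (eq_bigr _ (fun j _ => cleared_exponentE B i j)) big_split /=.
by rewrite homogenize_rowsum add0r.
Qed.

Lemma meval_cleared_exponent B x i : in_torus x ->
  ('X_[cleared_exponent B i] : {mpoly F[n.+1]}).@[proj_embed x] =
  proj_embed (monomial_map B x) i *
  \prod_j proj_embed x j ^ pole_order (homogenize B) j.
Proof.
move=> x0; rewrite mevalX proj_embed_monomial // -big_split.
apply: eq_bigr => j _ /=; rewrite exprnP cleared_exponentE.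
by rewrite expfzDr // proj_embed_torus.
Qed.

(** The cleared monomials are coprime because [pole_order] is attained in each
    column.  For another representative P the 2x2 minors of P and of the
    cleared monomials vanish on the points [1 : x] with x in the torus; being
    homogeneous, they vanish on the whole torus, so they are 0 as polynomials
    and [degree_of_monomials] applies. *)
Lemma has_degree_monomial_map B d :
  has_degree (@monomial_map F n B) d <-> (d : int) = mondeg B.
Proof.
have homX i :
    ('X_[cleared_exponent B i] : {mpoly F[n.+1]}) \is `|mondeg B|%N.-homog.
  by rewrite dhomogX -(mdeg_cleared_exponent B i).
split=> [[P [homP ncf repP]]|dE]; last first.
  exists (fun i => 'X_[cleared_exponent B i]); split.
  - by move=> i; have := homX i; rewrite -dE.
  - exact/no_common_factor_monomials/cleared_exponent_min.
  - by move=> x x0 i j; rewrite !meval_cleared_exponent // mulrAC [RHS]mulrAC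
      [_ * proj_embed _ j]mulrC.
rewrite -(mdeg_cleared_exponent B ord0); congr Posz.
apply: (degree_of_monomials (@cleared_exponent_min B) homP ncf) => i j.
apply/eqP; rewrite -subr_eq0; apply/eqP/mpoly_eq0_torus => y y0.
pose x k := y (lift ord0 k) / y ord0.
have x0 : in_torus x by move=> k; rewrite mulf_neq0 ?invr_neq0.
have yE : y =1 (fun k => y ord0 * proj_embed x k).
  move=> k; case: (unliftP ord0 k) => [l|] ->.
    by rewrite proj_embed_lift mulrC divfK.
  by rewrite proj_embed0 mulr1.
rewrite (meval_eq _ yE) (dhomog_meval (d := d + `|mondeg B|%N)); last first.
  by apply: rpredB; apply: dhomogM.
rewrite mevalB !mevalM !meval_cleared_exponent // !mulrA (repP x x0 i j).
by rewrite subrr mulr0.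
Qed.

Lemma has_degree_ext (g g' : ('I_n -> F) -> ('I_n -> F)) d :
  (forall x, in_torus x -> g x = g' x) -> has_degree g d -> has_degree g' d.
Proof.
move=> gg' [P [homP ncf rep]]; exists P; split => // x x0 i j.
by rewrite -gg' //; apply: rep.
Qed.

Lemma monomial_map_torus B x : in_torus x -> in_torus (monomial_map B x).
Proof.
by move=> x0 i; rewrite prodf_seq_neq0; apply/allP => j _; rewrite expfz_neq0.
Qed.

(** The torus is needed for x^(a + b) = x^a x^b with integer exponents. *)
Lemma monomial_mapM B C x : in_torus x ->
  monomial_map (B *m C) x = monomial_map B (monomial_map C x).
Proof.
move=> x0; apply/funext => i.
pose E j l := x l ^ (C j l * B i j).
have -> : monomial_map (B *m C) x i = \prod_l \prod_j E j l.
  apply: eq_bigr => l _; rewrite mxE.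
  rewrite (big_morph (fun z : int => x l ^ z) (id1 := 1) (op1 := *%R)) //.
    by apply: eq_bigr => j _; rewrite /E mulrC.
  by move=> a b; rewrite expfzDr.
rewrite exchange_big; apply: eq_bigr => j _ /=; rewrite /E /monomial_map.
rewrite (big_morph (fun z : F => z ^ B i j) (id1 := 1) (op1 := *%R)).
- by apply: eq_bigr => l _; rewrite exprz_exp.
- by move=> a b; rewrite expfzMl.
- exact: exp1rz.
Qed.

Lemma iter_monomial_map k B x : in_torus x ->
  iter k (@monomial_map F n B) x = monomial_map (B ^+ k) x.
Proof.
move=> x0; elim: k => [|k IHk].
  apply/funext => i /=; rewrite expr0 /monomial_map (bigD1 i) //= mxE eqxx.
  by rewrite expr1z big1 ?mulr1 // => j ji; rewrite mxE eq_sym (negPf ji).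
by rewrite iterS IHk exprS -monomial_mapM.
Qed.

Lemma rat_degree_iter k B :
  (rat_degree (iter k (@monomial_map F n B)) : int) = mondeg (B ^+ k).
Proof.
have degP d : has_degree (iter k (@monomial_map F n B)) d <->
    (d : int) = mondeg (B ^+ k).
  rewrite -has_degree_monomial_map; split; apply: has_degree_ext => x x0.
    exact: iter_monomial_map.
  by rewrite iter_monomial_map.
apply/degP/(@xgetPex _ 0%N [set d | has_degree _ d]%classic).
by exists `|mondeg (B ^+ k)|%N; apply/degP; rewrite gez0_abs // mondeg_ge0.
Qed.

End DegreeOfMonomialMaps.

(** * Spectral projections of diagonalizable matrices *)

Section Diagonalization.
Variables (K : fieldType) (n : nat).
Implicit Types (V M Q : 'M[K]_n) (d u v : 'rV[K]_n).

(** The rows of V are left eigenvectors of this matrix, with eigenvalues d. *)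
Definition diag_in V d : 'M[K]_n := invmx V *m diag_mx d *m V.

Lemma diag_inM V u v : V \in unitmx ->
  diag_in V u *m diag_in V v = diag_in V (\row_i (u 0 i * v 0 i)).
Proof.
move=> Vu; rewrite /diag_in !mulmxA mulmxK // -[_ *m diag_mx u *m _]mulmxA.
by rewrite mulmx_diag.
Qed.

Lemma diag_inX V d k : V \in unitmx ->
  diag_in V d ^+ k = diag_in V (\row_i d 0 i ^+ k).
Proof.
move=> Vu; elim: k => [|k IHk].
  rewrite expr0 /diag_in (_ : \row_i _ = const_mx 1); last first.
    by apply/rowP => i; rewrite !mxE.
  by rewrite diag_const_mx mulmx1 mulVmx.
rewrite exprS IHk [LHS]diag_inM //; congr diag_in; apply/rowP => i.
by rewrite !mxE exprS.
Qed.

Lemma diag_in_lin V u v a :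
  diag_in V u - a *: diag_in V v = diag_in V (u - a *: v).
Proof.
rewrite /diag_in linearB /= mulmxBr mulmxBl scalemxAl scalemxAr.
congr (_ - _ *m _ *m _); apply/matrixP => i j.
by rewrite !mxE mulrnAr.
Qed.

Lemma eigenvalue_diag_in V d z : V \in unitmx ->
  eigenvalue (diag_in V d) z <-> exists i, d 0 i = z.
Proof.
move=> Vu; split.
  case/eigenvalueP => v vd vn0.
  pose w := v *m invmx V.
  have wn0 : w != 0.
    by apply: contraNneq vn0 => w0; rewrite -[v](mulmxKV Vu) -/w w0 mul0mx.
  have wd : w *m diag_mx d = z *: w.
    by rewrite /w scalemxAl -vd /diag_in !mulmxA mulmxK.
  have /rV0Pn[i wi] := wn0; exists i.
  have /rowP/(_ i) := wd; rewrite mul_mx_diag !mxE mulrC => /(mulIf _); apply.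
  by rewrite mxE in wi.
case=> i <-; apply/eigenvalueP; exists (row i V).
  rewrite /diag_in !mulmxA -row_mul mulmxV // -row_mul mul1mx.
  by apply/rowP => j; rewrite -row_mul mul_diag_mx !mxE.
apply: contraTneq Vu => rowV0; rewrite -row_free_unit.
apply/negP => /row_freeP[W VW].
have /rowP/(_ i) : row i (V *m W) = 0 by rewrite row_mul rowV0 mul0mx.
by rewrite VW !mxE eqxx => /eqP; rewrite oner_eq0.
Qed.

(** The projection onto the eigenspace of z along the other eigenspaces. *)
Definition spectral_proj V d (z : K) : 'M[K]_n :=
  diag_in V (\row_i (d 0 i == z)%:R).

Section SpectralProjection.
Variables (V : 'M[K]_n) (d : 'rV[K]_n) (z : K).
Hypothesis Vu : V \in unitmx.
Let A := diag_in V d.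
Let P := spectral_proj V d z.

Lemma mulmx_spectral_proj : A *m P = z *: P.
Proof.
rewrite /A /P /spectral_proj diag_inM // /diag_in scalemxAl scalemxAr.
congr (_ *m _ *m _); apply/matrixP => i j; rewrite !mxE.
by rewrite !mulrnAr; have [->|_] := eqVneq (d 0 i) z.
Qed.

Lemma spectral_proj_mulmx : P *m A = z *: P.
Proof.
rewrite -mulmx_spectral_proj /A /P /spectral_proj !diag_inM //.
by congr diag_in; apply/rowP => i; rewrite !mxE mulrC.
Qed.

Lemma spectral_projK : P *m P = P.
Proof.
rewrite /P /spectral_proj diag_inM //; congr diag_in; apply/rowP => i.
by rewrite !mxE -natrM mulnb andbb.
Qed.

Lemma spectral_proj_id (Q : 'M[K]_n) : A *m Q = z *: Q -> P *m Q = Q.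
Proof.
move=> AQ; pose W := V *m Q.
have DW : diag_mx d *m W = z *: W.
  by rewrite /W scalemxAr -AQ /A /diag_in !mulmxA mulmxV // mul1mx.
rewrite /P /spectral_proj /diag_in -!mulmxA -/W.
rewrite (_ : diag_mx _ *m W = W) ?mulKmx //.
rewrite mul_diag_mx; apply/matrixP => i j; rewrite !mxE.
have [_|dz] := eqVneq (d 0 i) z; first by rewrite mul1r.
have /matrixP/(_ i j) := DW; rewrite mul_diag_mx !mxE => /eqP.
rewrite -subr_eq0 -mulrBl mulf_eq0 subr_eq0 (negPf dz) /= => /eqP.
by move=> ->; rewrite mulr0.
Qed.

Lemma id_spectral_proj (Q : 'M[K]_n) : Q *m A = z *: Q -> Q *m P = Q.
Proof.
move=> QA; pose W := Q *m invmx V.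
have WD : W *m diag_mx d = z *: W.
  by rewrite /W scalemxAl -QA /A /diag_in !mulmxA mulmxK.
rewrite /P /spectral_proj /diag_in !mulmxA -/W.
rewrite (_ : W *m diag_mx _ = W) ?mulmxKV //.
rewrite mul_mx_diag; apply/matrixP => i j; rewrite !mxE.
have [_|dz] := eqVneq (d 0 j) z; first by rewrite mulr1.
have /matrixP/(_ i j) := WD; rewrite mul_mx_diag !mxE mulrC => /eqP.
rewrite -subr_eq0 -mulrBl mulf_eq0 subr_eq0 (negPf dz) /= => /eqP.
by move=> ->; rewrite mul0r.
Qed.

Lemma spectral_proj_neq0 : (exists i, d 0 i = z) -> P != 0.
Proof.
case=> i di; apply/negP => /eqP P0.
have : diag_mx (\row_j (d 0 j == z)%:R) = 0 :> 'M[K]_n.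
  have /(congr1 (fun M => V *m M *m invmx V)) := P0.
  rewrite /P /spectral_proj /diag_in !mulmxA mulmxV // mul1mx mulmxK //.
  by rewrite mulmx0 mul0mx.
move/matrixP/(_ i i); rewrite !mxE di !eqxx => /eqP.
by rewrite oner_eq0.
Qed.

End SpectralProjection.

(** If P and P' are the projections given by two diagonalizations of A, then
    P P' = P' because A P' = z P', and P P' = P because P A = z P. *)
Lemma spectral_proj_unique V d V' d' z :
  V \in unitmx -> V' \in unitmx -> diag_in V d = diag_in V' d' ->
  spectral_proj V d z = spectral_proj V' d' z.
Proof.
move=> Vu V'u eqA.
rewrite -[LHS](@id_spectral_proj V' d' z) // -?eqA ?spectral_proj_mulmx //.
by rewrite spectral_proj_id // eqA mulmx_spectral_proj.
Qed.

End Diagonalization.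

Lemma map_mxX (K L : nzRingType) (f : {rmorphism K -> L}) n (M : 'M[K]_n) k :
  map_mx f (M ^+ k) = map_mx f M ^+ k.
Proof.
elim: k => [|k IHk]; first by rewrite !expr0; apply: map_mx1.
by rewrite !exprS -IHk; apply: map_mxM.
Qed.

(** * The dominant part of the powers of a real matrix *)

Section DominantPart.
Variables (R : rcfType) (n : nat).
Local Notation toC := (real_complex R).

(** Conjugating a diagonalization of the real matrix A gives another one, and it
    sends the spectral projection of the real number l to its conjugate;
    uniqueness makes the two equal. *)
Lemma spectral_proj_real (A : 'M[R]_n) (V : 'M[R[i]]_n) (d : 'rV[R[i]]_n)
    (l : R) :
  V \in unitmx -> map_mx toC A = diag_in V d ->
  exists P : 'M[R]_n, map_mx toC P = spectral_proj V d l%:C.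
Proof.
move=> Vu AE; set P := spectral_proj V d _.
pose cj (M : 'M[R[i]]_n) := map_mx (@conjc R) M.
have conj_diag V' d' :
    cj (diag_in V' d') = diag_in (cj V') (map_mx (@conjc R) d').
  by rewrite /cj /diag_in !map_mxM map_diag_mx map_invmx.
have cjP : cj P = P.
  rewrite /P /spectral_proj conj_diag; set e := map_mx _ _.
  have -> : e = \row_i (map_mx (@conjc R) d 0 i == l%:C)%:R.
    apply/rowP => i; rewrite !mxE rmorph_nat; congr ((nat_of_bool _)%:R).
    by rewrite -[X in _ = (_ == X)]conjc_real (inj_eq (inv_inj (@conjcK R))).
  apply: spectral_proj_unique; rewrite ?map_unitmx //.
  rewrite -conj_diag -AE /cj; apply/matrixP => i j.
  by rewrite !mxE conjc_real.
exists (map_mx (fun c => complex.Re c) P); apply/matrixP => i j.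
rewrite [LHS]mxE [X in X%:C]mxE.
have /matrixP/(_ i j) := cjP; rewrite mxE.
by case: (P i j) => a b [] /eqP; rewrite -subr_eq0 -opprD oppr_eq0 -mulr2n
  mulrn_eq0 /= => /eqP ->.
Qed.

Lemma normc_ge0 (z : R[i]) : 0 <= Normc.normc z.
Proof. by case: z => a b; apply: sqrtr_ge0. Qed.

(** All entries of a matrix diagonal in a fixed basis are bounded by the
    eigenvalues, with a constant depending on the basis only. *)
Lemma diag_in_bound (V : 'M[R[i]]_n) : exists2 c : R, 0 <= c &
  forall (r : 'rV[R[i]]_n) e, (forall s, Normc.normc (r 0 s) <= e) ->
  forall i j, `|diag_in V r i j| <= (c * e)%:C.
Proof.
pose w i j s : R := Normc.normc (invmx V i s) * Normc.normc (V s j).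
have w_ge0 i j s : 0 <= w i j s by rewrite mulr_ge0 ?normc_ge0.
exists (\sum_i \sum_j \sum_s w i j s) => [|r e re i j].
  by do 3![apply: sumr_ge0 => ? _].
apply: (@le_trans _ _ (\sum_s w i j s * e)%:C).
  rewrite /diag_in mul_mx_diag mxE (le_trans (ler_norm_sum _ _ _)) //.
  rewrite rmorph_sum.
  apply: ler_sum => s _; rewrite mxE !normrM mulrAC.
  rewrite rmorphM /= rmorphM /=; apply: ler_wpM2l.
    by rewrite mulr_ge0 ?normr_ge0.
  by rewrite lecR.
rewrite lecR -mulr_suml; apply: ler_wpM2r.
  exact: le_trans (normc_ge0 _) (re i).
rewrite [leRHS](bigD1 i) //= [X in X + _](bigD1 j) //= -addrA lerDl addr_ge0 //.
  by do 2![apply: sumr_ge0 => ? _].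
by do 3![apply: sumr_ge0 => ? _].
Qed.

(** The difference is diagonal in the same basis, with eigenvalue 0 on the
    eigenspace of l and d_s^k elsewhere.  The bound e is left free so that
    e = 0 is allowed when l is the only eigenvalue. *)
Lemma spectral_error (A P : 'M[R]_n) (V : 'M[R[i]]_n) (d : 'rV[R[i]]_n)
    (l : R) :
  V \in unitmx -> map_mx toC A = diag_in V d ->
  map_mx toC P = spectral_proj V d l%:C ->
  exists2 c : R, 0 <= c &
  forall k e, 0 <= e ->
  (forall s, d 0 s != l%:C -> Normc.normc (d 0 s) ^+ k <= e) ->
  forall i j, `|(A ^+ k - l ^+ k *: P) i j| <= c * e.
Proof.
move=> Vu AE PE; have [c c0 bound] := diag_in_bound V.
exists c => // k e e0 de i j.
pose r : 'rV[R[i]]_n := \row_s (if d 0 s == l%:C then 0 else d 0 s ^+ k).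
have rE : map_mx toC (A ^+ k - l ^+ k *: P) = diag_in V r.
  rewrite map_mxB map_mxZ PE map_mxX AE (diag_inX _ _ Vu) /spectral_proj.
  rewrite diag_in_lin; congr diag_in; apply/rowP => s; rewrite !mxE rmorphXn /=.
  by have [->|_] := eqVneq (d 0 s) l%:C; rewrite ?mulr1 ?mulr0 ?subrr ?subr0.
have normcX (z : R[i]) : Normc.normc (z ^+ k) = Normc.normc z ^+ k.
  elim: k {de r rE} => [|k IHk]; first by rewrite !expr0 Normc.normc1.
  by rewrite !exprS Normc.normcM IHk.
have := bound r e; rewrite -rE => /(_ _ i j); rewrite mxE.
rewrite normc_def /= expr0n addr0 sqrtr_sqr lecR; apply=> s.
rewrite mxE; case: eqP => [_|/eqP ds]; first by rewrite Normc.normc0.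
by rewrite normcX de.
Qed.

End DominantPart.

(** * Asymptotics of the degrees *)

From mathcomp Require Import topology normedtype landau.
Import numFieldNormedType.Exports.
Local Open Scope classical_set_scope.
Local Open Scope ring_scope.
Local Open Scope complex_scope.

Theorem theorem6p7 (R : realType) (n : nat) (A : 'M[int]_n)
    (lambda1 : R) (lambdas : seq R[i])
    (detA : \det A != 0)
    (diagA : diagonalizable (map_mx (intr : int -> R[i]) A))
    (uniq_lambda : uniq (lambda1%:C :: lambdas))
    (eigA : forall z : R[i],
       eigenvalue (map_mx (intr : int -> R[i]) A) z =
       (z \in lambda1%:C :: lambdas))
    (lambda1_neg : lambda1 < 0)
    (lambda1_dom : forall z, z \in lambdas -> Normc.normc z < - lambda1)
    (lambdas_sorted :
       sorted (fun z w => Normc.normc w <= Normc.normc z)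
         lambdas) :
  exists C0 C1 : R,
    [/\ 0 < C0, 0 < C1, 1 <= C0, C0 <= C1 ^+ 2 &
      forall l : nat, (l < 2)%N ->
        let Cl := if l == 0%N then C0 else C1 in
        let deg (k : nat) : R :=
          (rat_degree (iter (2 * k + l)
             (@monomial_map R[i] n A)))%:R in
        let err (k : nat) : R := deg k - Cl * `|lambda1| ^+ (2 * k + l) in
        match lambdas with
        | [::] => forall k, err k = 0
        | lambda2 :: _ =>
            err =O_\oo (fun k : nat => Normc.normc lambda2 ^+ (2 * k + l))
        end].
Proof.
pose AR : 'M[R]_n := map_mx intr A.
have ARE : map_mx (real_complex R) AR = map_mx (intr : int -> R[i]) A.
  by apply/matrixP => i j; rewrite !mxE rmorph_int.
have [V Vu /(diagonalizable_forLR Vu)[d AE]] := diagA.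
have {}AE : map_mx (intr : int -> R[i]) A = diag_in V d.
  by rewrite AE mxpoly.conjVmx.
have eig_d z : (z \in lambda1%:C :: lambdas) <-> exists i, d 0 i = z.
  by rewrite -eigA AE; apply: eigenvalue_diag_in.
have [P PE] := spectral_proj_real lambda1 Vu (etrans ARE AE).
have P_idem : P *m P = P.
  apply: (map_mx_inj (f := real_complex R)).
  by rewrite map_mxM PE; apply: spectral_projK.
have P_neq0 : P != 0.
  have : spectral_proj V d lambda1%:C != 0.
    by apply: spectral_proj_neq0 => //; apply/eig_d/mem_head.
  by rewrite -PE; apply: contraNneq => ->; rewrite map_mx0.
have [c c_ge0 error] := spectral_error Vu (etrans ARE AE) PE.
have CP_gt0 : 0 < mondeg P.
  rewrite lt_def mondeg_ge0 andbT.
  by apply: contraNneq P_neq0 => /mondeg_eq0 ->.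
have CP_ge1 : 1 <= mondeg P.
  by rewrite -(ler_pM2l CP_gt0) mulr1 -[in leLHS]P_idem mondegM.
have CP_le : mondeg P <= mondeg (- P) ^+ 2.
  by rewrite -[in leLHS]P_idem -[P *m P]opprK -mulmxN -mulNmx expr2 mondegM.
have CN_gt0 : 0 < mondeg (- P).
  rewrite lt_def mondeg_ge0 andbT; apply: contraTneq CP_le => ->.
  by rewrite expr0n /= -ltNge.
exists (mondeg P), (mondeg (- P)); split => // l l2 Cl deg err.
pose N k := (2 * k + l)%N.
have CE k : Cl * `|lambda1| ^+ N k = mondeg (lambda1 ^+ N k *: P).
  (* Only the nonnegative factor of lambda1^N can be taken out of mondeg. *)
  rewrite -[X in X ^+ _ *: _]opprK -(ltr0_norm lambda1_neg) exprNn.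
  rewrite [(-1) ^+ _ * _]mulrC -scalerA mondegZ ?exprn_ge0 // mulrC.
  congr (_ * _).
  rewrite /N -signr_odd oddD oddM /= /Cl.
  case: l l2 {Cl deg err N} => [|[|]] //= _.
    by rewrite expr0 scale1r.
  by rewrite expr1 scaleN1r.
have degE k : deg k = mondeg (AR ^+ N k).
  rewrite /deg -[LHS]/((Posz _)%:~R) rat_degree_iter -mondeg_intr.
  by rewrite /AR map_mxX.
have errE k e : 0 <= e ->
    (forall s, d 0 s != lambda1%:C -> Normc.normc (d 0 s) ^+ N k <= e) ->
    `|err k| <= c * (n + n)%:R * e.
  move=> e0 de; rewrite /err -/(N k) CE degE mulrAC mulr_natr.
  apply: mondeg_lipschitz; first by rewrite mulr_ge0.
  exact: error.
have eig_rest s : d 0 s != lambda1%:C -> d 0 s \in lambdas.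
  have : d 0 s \in lambda1%:C :: lambdas by apply/eig_d; exists s.
  by rewrite inE => /orP[->|].
case: lambdas lambdas_sorted eig_rest {uniq_lambda eigA lambda1_dom eig_d}
  => [|lambda2 lambdas] sorted_l eig_rest.
  move=> k; apply/eqP; rewrite -normr_le0 -(mulr0 (c * (n + n)%:R)).
  by apply: errE => // s /eig_rest; rewrite in_nil.
have le_lambda2 z :
    z \in lambda2 :: lambdas -> Normc.normc z <= Normc.normc lambda2.
  rewrite inE => /orP[/eqP ->//|]; apply/allP: z.
  by apply: order_path_min sorted_l => x y z xy yz; apply: le_trans yz xy.
apply/eqO_exP; exists (c * (n + n)%:R + 1).
  by rewrite ltr_wpDl ?ltr01 // mulr_ge0.
near=> k.
rewrite [X in _ <= _ * X]ger0_norm ?exprn_ge0 ?normc_ge0 //.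
rewrite mulrDl mul1r (le_trans (errE k (Normc.normc lambda2 ^+ N k) _ _)) //.
- by rewrite exprn_ge0 ?normc_ge0.
- by move=> s /eig_rest/le_lambda2; apply: lerXn2r; rewrite nnegrE normc_ge0.
- by rewrite lerDl exprn_ge0 ?normc_ge0.
Unshelve. all: by end_near.
Qed.
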